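(* The restricted steepness pairing is a Morse matching on $\mathrm{F}^+\mathrm{K}$.
   Context: **The simplicial monoid.** Let $K$ be the simplicial set with a unique $0$-simplex $e$ and a single nondegenerate $1$-simplex $y$, all other simplices being iterated degeneracies of these (so $|K|\cong S^1$). For $n\ge 0$ let $\mathrm{F}^+\mathrm{K}_n$ be the free monoid generated by the elements of $K_n$, modulo the single relation $s_0^n(e)=1$; the face and degeneracy operators of $\mathrm{F}^+\mathrm{K}$ are the unique monoid homomorphisms extending those of $K$. The identity element of every $\mathrm{F}^+\mathrm{K}_n$ is denoted $e$. For $n\ge 1$ and $1\le k\le n$ set $\alpha_k^{(n)}=s_0^{\,n-k}s_1^{\,k-1}y$ (so $\alpha_1^{(1)}=y$). Then $\mathrm{F}^+\mathrm{K}_0$ is trivial, and for $n\ge1$, $\mathrm{F}^+\mathrm{K}_n$ is the free monoid on $\alpha_1^{(n)},\dots,\alpha_n^{(n)}$. The faces, for $n\ge 2$, are $d_i(\alpha_k^{(n)})=\alpha_k^{(n-1)}$ for $0\le i\le n-k$ and $d_i(\alpha_k^{(n)})=\alpha_{k-1}^{(n-1)}$ for $n-k+1\le i\le n$, where $\alpha_0^{(n-1)}$ and $\alpha_n^{(n-1)}$ are to be read as $e$; also $d_0y=d_1y=e$. The word length of a simplex is its length as a word in the generators. Faces never increase word length. **Order.** Order the generators of $\mathrm{F}^+\mathrm{K}_n$ by $\alpha_1^{(n)}<\dots<\alpha_n^{(n)}$, order words of the same length $\ell$ lexicographically, and declare words of length $\ell$ smaller than words of length $\ell+1$. **Restricted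 steepness pairing.** An $n$-simplex $\sigma$ is a regular face of an $(n+1)$-simplex $\tau$ if $\sigma=d_i\tau$ for exactly one index $i$. The restricted steepness pairing is the set of pairs $\{\sigma\prec\tau\}$, with $\sigma$ an $n$-simplex and $\tau$ an $(n+1)$-simplex ($n\ge0$), both nondegenerate and of the same word length $\ell$, such that: (i) $\sigma$ is a regular face of $\tau$; (ii) every nondegenerate word-length-$\ell$ face $\alpha\ne\sigma$ of $\tau$ satisfies $\alpha<\sigma$; (iii) every nondegenerate $(n+1)$-simplex $\mu\neq\tau$ of word length $\ell$ having $\sigma$ as a face (regular or not) satisfies $\tau<\mu$. All simplices not in a pair, including all degenerate simplices, are called critical. **Morse matching.** For a simplicial set $X$, write $x<y$ if $x=d_iy$ for some $i$ (for simplices of consecutive dimensions). A Morse matching on $X$ consists of a partition $X_n=A_n\cup B_n\cup C_n$ for each $n$, and a bijection $c:A_n\to B_{n+1}$ for each $n$, such that if $c(\sigma)=\tau$ then $\sigma$ is a regular face of $\tau$; write $\sigma\prec\tau$ if $\tau=c(\sigma)$. It is required that: (1) there are no paths $\sigma_0\prec\tau_0>\sigma_1\prec\tau_1>\cdots\prec\tau_k>\sigma_0$ with the $\sigma_i$ distinct and $k>0$; (2) there are no infinite paths $\sigma_0\prec\tau_0>\sigma_1\prec\tau_1>\sigma_2\prec\cdots$ with each $\sigma_i\in A_n$ and $\sigma_{i+1}\ne\sigma_i$ for all $i$. For a pairing, $A_n$ and $B_{n}$ are the sets of lower, respectively upper, members of pairs of dimension $n$, $c$ is given by the pairs, and $C_n$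 is the set of critical $n$-simplices. *)

(* Defs.v *)
From mathcomp Require Import all_boot all_order.
From mathcomp Require Import zify.

Set Implicit Arguments.
Unset Strict Implicit.
Unset Printing Implicit Defensive.

(** * Simplicial sets *)

(* In the identities, [lift ord0 j] has value [j.+1], and [widen_ord] keeps
   the value of an index. *)
Record sset := SSet {
  simplex :> nat -> Type;
  face : forall n, 'I_n.+2 -> simplex n.+1 -> simplex n;
  degen : forall n, 'I_n.+1 -> simplex n -> simplex n.+1;
  face_face : forall n (i j : 'I_n.+2) (x : simplex n.+2), i <= j ->
    face i (face (lift ord0 j) x) = face j (face (widen_ord (leqnSn _) i) x);
  face_degen_lt : forall n (i : 'I_n.+2) (j : 'I_n.+1) (x : simplex n.+1),
    i <= j ->
    face (widen_ord (leqnSn _) i) (degen (lift ord0 j) x) = degen j (face i x);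
  face_degen_eq : forall n (j : 'I_n.+1) (x : simplex n),
    face (widen_ord (leqnSn _) j) (degen j x) = x;
  face_degen_eqS : forall n (j : 'I_n.+1) (x : simplex n),
    face (lift ord0 j) (degen j x) = x;
  face_degen_gt : forall n (i : 'I_n.+2) (j : 'I_n.+1) (x : simplex n.+1),
    j < i ->
    face (lift ord0 i) (degen (widen_ord (leqnSn _) j) x) = degen j (face i x);
  degen_degen : forall n (i j : 'I_n.+1) (x : simplex n), i <= j ->
    degen (widen_ord (leqnSn _) i) (degen j x) = degen (lift ord0 j) (degen i x)
}.

Arguments face {s n} i x.
Arguments degen {s n} j x.

Section Faces.
Variable X : sset.

Definition is_face n (x : X n) (y : X n.+1) : Prop := exists i, x = face i y.

Definition regular_face n (x : X n) (y : X n.+1) : Prop :=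
  exists! i, x = face i y.

Definition degenerate n : X n -> Prop :=
  if n is m.+1 then fun x : X m.+1 => exists j (z : X m), x = degen j z
  else fun=> False.

Definition nondegenerate n (x : X n) : Prop := ~ degenerate x.

End Faces.

(** * Morse matchings *)

Definition bijection_graph (S T : Type) (A : S -> Prop) (B : T -> Prop)
    (c : S -> T -> Prop) : Prop :=
  [/\ forall x y, c x y -> A x /\ B y,
      forall x, A x -> exists! y, c x y &
      forall y, B y -> exists! x, c x y].

(* The bijections A_n -> B_(n+1) are given by their graphs. *)
Record Morse_matching (X : sset) (A B C : forall n, X n -> Prop)
    (c : forall n, X n -> X n.+1 -> Prop) : Prop := {
  Morse_cover : forall n (x : X n), [\/ A n x, B n x | C n x];
  Morse_disjoint : forall n (x : X n),
    [/\ ~ (A n x /\ B n x), ~ (A n x /\ C n x) & ~ (B n x /\ C n x)];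
  Morse_bijection : forall n, bijection_graph (A n) (B n.+1) (c n);
  Morse_regular : forall n (x : X n) (y : X n.+1), c n x y -> regular_face x y;
  Morse_acyclic : forall n k (x : nat -> X n) (y : nat -> X n.+1),
    0 < k ->
    (forall i j, i <= k -> j <= k -> x i = x j -> i = j) ->
    (forall i, i <= k -> c n (x i) (y i)) ->
    (forall i, i < k -> is_face (x i.+1) (y i)) ->
    ~ is_face (x 0) (y k);
  Morse_finite : forall n (x : nat -> X n) (y : nat -> X n.+1),
    ~ [/\ forall i, A n (x i),
          forall i, x i.+1 <> x i,
          forall i, c n (x i) (y i) &
          forall i, is_face (x i.+1) (y i)]
}.

Section Pairings.
Variables (X : sset) (P : forall n, X n -> X n.+1 -> Prop).

Definition lower n (x : X n) : Prop := exists y, P x y.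

Definition upper n : X n -> Prop :=
  if n is m.+1 then fun y : X m.+1 => exists x, P x y else fun=> False.

Definition critical n (x : X n) : Prop := ~ lower x /\ ~ upper x.

Definition Morse_pairing : Prop :=
  Morse_matching lower upper critical P.

End Pairings.

(** * The simplicial circle K *)

(* [None : Kn n] is the degeneracy s_0^n e of the vertex, and [Some a] is
   alpha_(a+1)^(n): the index of a generator is shifted by one. *)
Definition Kn (n : nat) : Type := option 'I_n.

(* alpha_k^(n), read as (a degeneracy of) e if k = 0 or k > n *)
Definition alpha n (k : nat) : Kn n := if k is a.+1 then insub a else None.

Definition K_face n (i : 'I_n.+2) (x : Kn n.+1) : Kn n :=
  if x is Some a then
    let k := a.+1 in alpha n (if i <= n.+1 - k then k else k.-1)
  else None.

Definition K_degen n (j : 'I_n.+1) (x : Kn n) : Kn n.+1 :=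
  if x is Some a then
    let k := a.+1 in alpha n.+1 (if j <= n - k then k else k.+1)
  else None.

Arguments alpha n k : simpl never.

Lemma alphaP n k :
  (exists2 a : 'I_n, k = a.+1 & alpha n k = Some a) \/
  ((k == 0) || (n < k)) /\ alpha n k = None.
Proof.
rewrite /alpha; case: k => [|a]; first by right.
case: insubP => [u lt_an ua|nlt]; [left | right].
  by exists u => //; rewrite ua.
by split=> //; rewrite ltnS leqNgt.
Qed.

Lemma K_faceE n (i : 'I_n.+2) k : k <= n.+1 ->
  K_face i (alpha n.+1 k) = alpha n (if i <= n.+1 - k then k else k.-1).
Proof.
move=> lek; case: (alphaP n.+1 k) => [[a -> ->] //|[k0 ->]] /=.
have -> : k = 0 by lia.
by case: ifP.
Qed.

Lemma K_degenE n (j : 'I_n.+1) k : 0 < k <= n ->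
  K_degen j (alpha n k) = alpha n.+1 (if j <= n - k then k else k.+1).
Proof.
by move=> lek; case: (alphaP n k) => [[a -> ->] //|[k0 _]]; lia.
Qed.

Lemma alpha_out n k : (k == 0) || (n < k) -> alpha n k = None.
Proof. by case: (alphaP n k) => [[a -> _]|[_ ->]] //; case: a => a /=; lia. Qed.

Lemma Some_alpha n (a : 'I_n) : Some a = alpha n a.+1.
Proof. by rewrite /alpha valK. Qed.

Local Ltac split_ifs :=
  repeat match goal with |- context [if ?b then _ else _] =>
    lazymatch b with
    | context [if _ then _ else _] => fail
    | _ => case: (boolP b) => ? /=
    end
  end.

Lemma K_face_faceE n (i : 'I_n.+2) (j : 'I_n.+3) (a : 'I_n.+2) :
  K_face i (K_face j (Some a)) =
  let k := if j <= n.+2 - a.+1 then a.+1 else a in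
  if k <= n.+1 then alpha n (if i <= n.+1 - k then k else k.-1) else None.
Proof.
have lta := ltn_ord a; rewrite Some_alpha K_faceE //=.
set k := if j <= _ then _ else _.
have [le_kn|lt_nk] := leqP k n.+1; first by rewrite K_faceE.
by rewrite [alpha n.+1 _]alpha_out // lt_nk orbT.
Qed.

Lemma K_face_face n (i j : 'I_n.+2) (x : Kn n.+2) : i <= j ->
  K_face i (K_face (lift ord0 j) x)
  = K_face j (K_face (widen_ord (leqnSn _) i) x).
Proof.
case: x => // a le_ij; have lta := ltn_ord a; have ltj := ltn_ord j.
rewrite !K_face_faceE /= /bump ?leq0n ?add1n.
by split_ifs => //; try (congr alpha; lia); rewrite ?alpha_out //; lia.
Qed.

Lemma K_face_degen n (i : 'I_n.+2) (j : 'I_n.+1) (a : 'I_n) :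
  K_face i (K_degen j (Some a)) =
  alpha n (let k := if j <= n - a.+1 then a.+1 else a.+2 in
           if i <= n.+1 - k then k else k.-1).
Proof.
have lta := ltn_ord a.
by rewrite Some_alpha K_degenE ?K_faceE //; case: ifP; lia.
Qed.

Lemma K_degen_face n (i : 'I_n.+2) (j : 'I_n.+1) (a : 'I_n.+1) :
  K_degen j (K_face i (Some a)) =
  let k := if i <= n.+1 - a.+1 then a.+1 else a in
  if 0 < k <= n then alpha n.+1 (if j <= n - k then k else k.+1) else None.
Proof.
have lta := ltn_ord a.
rewrite Some_alpha K_faceE //=.
set k := if i <= _ then _ else _.
case: (boolP (0 < k <= n)) => [k_in|k_out]; first by rewrite K_degenE.
by rewrite [alpha n k]alpha_out //; lia.
Qed.

Lemma K_face_degen_lt n (i : 'I_n.+2) (j : 'I_n.+1) (x : Kn n.+1) : i <= j ->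
  K_face (widen_ord (leqnSn _) i) (K_degen (lift ord0 j) x)
  = K_degen j (K_face i x).
Proof.
case: x => // a le_ij; have lta := ltn_ord a; have ltj := ltn_ord j.
rewrite K_face_degen K_degen_face /= /bump ?leq0n ?add1n.
by split_ifs => //; try (congr alpha; lia); rewrite ?alpha_out //; lia.
Qed.

Lemma K_face_degen_eq n (j : 'I_n.+1) (x : Kn n) :
  K_face (widen_ord (leqnSn _) j) (K_degen j x) = x.
Proof.
case: x => // a; have lta := ltn_ord a; have ltj := ltn_ord j.
rewrite K_face_degen [RHS]Some_alpha /=.
by split_ifs; congr alpha; lia.
Qed.

Lemma K_face_degen_eqS n (j : 'I_n.+1) (x : Kn n) :
  K_face (lift ord0 j) (K_degen j x) = x.
Proof.
case: x => // a; have lta := ltn_ord a; have ltj := ltn_ord j.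
rewrite K_face_degen [RHS]Some_alpha /= /bump ?leq0n ?add1n.
by split_ifs; congr alpha; lia.
Qed.

Lemma K_face_degen_gt n (i : 'I_n.+2) (j : 'I_n.+1) (x : Kn n.+1) : j < i ->
  K_face (lift ord0 i) (K_degen (widen_ord (leqnSn _) j) x)
  = K_degen j (K_face i x).
Proof.
case: x => // a le_ij; have lta := ltn_ord a; have lti := ltn_ord i.
rewrite K_face_degen K_degen_face /= /bump ?leq0n ?add1n.
by split_ifs => //; try (congr alpha; lia); rewrite ?alpha_out //; lia.
Qed.

Lemma K_degen_degen n (i j : 'I_n.+1) (x : Kn n) : i <= j ->
  K_degen (widen_ord (leqnSn _) i) (K_degen j x)
  = K_degen (lift ord0 j) (K_degen i x).
Proof.
case: x => // a le_ij; have lta := ltn_ord a; have ltj := ltn_ord j.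
rewrite Some_alpha !K_degenE //=; try (split_ifs; lia).
rewrite /bump ?leq0n ?add1n.
by split_ifs; congr alpha; lia.
Qed.

Definition K : sset :=
  @SSet Kn K_face K_degen K_face_face K_face_degen_lt K_face_degen_eq
    K_face_degen_eqS K_face_degen_gt K_degen_degen.

(* The next lemmas say that K is the intended simplicial set: its only
   nondegenerate simplices are the vertex [None] and y = alpha_1^(1), and
   alpha_k^(n) = s_0^(n-k) s_1^(k-1) y. *)
Lemma degen1_alpha n (n1 : 1 < n.+1) :
  degen (Ordinal n1) (alpha n n : K n) = alpha n.+1 n.+1.
Proof. by rewrite /= K_degenE ?subnn //; lia. Qed.

Lemma degen0_alpha n k : k <= n ->
  degen ord0 (alpha n k : K n) = alpha n.+1 k.
Proof. by case: k => // k lek; rewrite /= K_degenE. Qed.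

Lemma K_nondegenerate n (x : K n) :
  nondegenerate x <-> n = 0 \/ n = 1 /\ x = alpha n 1.
Proof.
case: n x => [|[|n]] x; first by split=> [_|_ []]; left.
  split=> [ndx|[//|[_ ->]]]; last first.
    by rewrite /alpha insubT => -[j [[[]|]]].
  right; split=> //; case: x ndx => [a _|[]].
    by rewrite Some_alpha; congr alpha; case: a => -[].
  by exists ord0, None.
split=> [ndx|[//|[]//]]; case: ndx; case: x => [a|].
  have := ltn_ord a; rewrite ltnS leq_eqVlt => /predU1P[ea|lea].
    exists (Ordinal (isT : 1 < n.+2)), (alpha n.+1 n.+1).
    by rewrite degen1_alpha Some_alpha ea.
  exists ord0, (alpha n.+1 a.+1).
  by rewrite degen0_alpha // Some_alpha.
by exists ord0, None.
Qed.

(** * The simplicial monoid F^+ K *)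

(* Since s_0^n e = 1 kills the generator [None], the n-simplices are the words
   in the remaining generators. *)
Definition FKn (n : nat) : Type := seq 'I_n.

Definition gen n (x : Kn n) : FKn n := if x is Some a then [:: a] else [::].

Definition Fmap m n (f : Kn m -> Kn n) (w : FKn m) : FKn n :=
  pmap (fun a => f (Some a)) w.

(* FKn is the monoid generated by Kn modulo s_0^n e = 1 *)
Lemma FK_universal n (M : monoidType) (f : Kn n -> M) : f None = 1%g ->
  exists2 g : FKn n -> M,
    [/\ g [::] = 1%g, {morph g : v w / v ++ w >-> (v * w)%g} &
        forall x, g (gen x) = f x] &
  forall h : FKn n -> M,
    [/\ h [::] = 1%g, {morph h : v w / v ++ w >-> (v * w)%g} &
        forall x, h (gen x) = f x] -> h =1 g.
Proof.
move=> fN; exists (fun w => \prod_(a <- w) f (Some a))%g.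
  split=> [|v w|[a|]]; rewrite ?big_nil ?big_cat ?big_seq1 //.
move=> h [h0 hM hE]; elim=> [|a w IHw]; first by rewrite big_nil.
by rewrite big_cons -IHw -hE -hM.
Qed.

Lemma Fmap_cat m n (f : Kn m -> Kn n) v w :
  Fmap f (v ++ w) = Fmap f v ++ Fmap f w.
Proof. exact: pmap_cat. Qed.

Lemma Fmap_gen m n (f : Kn m -> Kn n) x : f None = None ->
  Fmap f (gen x) = gen (f x).
Proof. by case: x => [a|] /= fN; rewrite ?fN //= /gen; case: (f _). Qed.

Lemma Fmap_comp l m n (f : Kn m -> Kn n) (g : Kn l -> Kn m) w :
  f None = None -> Fmap f (Fmap g w) = Fmap (f \o g) w.
Proof.
move=> fN; elim: w => //= a w IHw.
by case: (g (Some a)) => [b|] /=; rewrite ?fN //= ?IHw; case: (f _).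
Qed.

Lemma Fmap_id n (f : Kn n -> Kn n) w : f =1 id -> Fmap f w = w.
Proof. by move=> fE; elim: w => //= a w IHw; rewrite fE /= IHw. Qed.

Lemma eq_Fmap m n (f g : Kn m -> Kn n) w : f =1 g -> Fmap f w = Fmap g w.
Proof. by move=> fg; apply: eq_pmap => a; apply: fg. Qed.

(* The monoid homomorphisms extending the faces and degeneracies of K *)
Definition FK_face n (i : 'I_n.+2) : FKn n.+1 -> FKn n := Fmap (K_face i).
Definition FK_degen n (j : 'I_n.+1) : FKn n -> FKn n.+1 := Fmap (K_degen j).

Lemma FK_face_face n (i j : 'I_n.+2) (x : FKn n.+2) : i <= j ->
  FK_face i (FK_face (lift ord0 j) x)
  = FK_face j (FK_face (widen_ord (leqnSn _) i) x).
Proof.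
by move=> le_ij; rewrite /FK_face !Fmap_comp //; apply: eq_Fmap => a;
  apply: K_face_face.
Qed.

Lemma FK_face_degen_lt n (i : 'I_n.+2) (j : 'I_n.+1) (x : FKn n.+1) : i <= j ->
  FK_face (widen_ord (leqnSn _) i) (FK_degen (lift ord0 j) x)
  = FK_degen j (FK_face i x).
Proof.
by move=> le_ij; rewrite /FK_face /FK_degen !Fmap_comp //;
  apply: eq_Fmap => a; apply: K_face_degen_lt.
Qed.

Lemma FK_face_degen_eq n (j : 'I_n.+1) (x : FKn n) :
  FK_face (widen_ord (leqnSn _) j) (FK_degen j x) = x.
Proof.
by rewrite /FK_face /FK_degen Fmap_comp // Fmap_id // => a;
  apply: K_face_degen_eq.
Qed.

Lemma FK_face_degen_eqS n (j : 'I_n.+1) (x : FKn n) :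
  FK_face (lift ord0 j) (FK_degen j x) = x.
Proof.
by rewrite /FK_face /FK_degen Fmap_comp // Fmap_id // => a;
  apply: K_face_degen_eqS.
Qed.

Lemma FK_face_degen_gt n (i : 'I_n.+2) (j : 'I_n.+1) (x : FKn n.+1) : j < i ->
  FK_face (lift ord0 i) (FK_degen (widen_ord (leqnSn _) j) x)
  = FK_degen j (FK_face i x).
Proof.
by move=> lt_ji; rewrite /FK_face /FK_degen !Fmap_comp //;
  apply: eq_Fmap => a; apply: K_face_degen_gt.
Qed.

Lemma FK_degen_degen n (i j : 'I_n.+1) (x : FKn n) : i <= j ->
  FK_degen (widen_ord (leqnSn _) i) (FK_degen j x)
  = FK_degen (lift ord0 j) (FK_degen i x).
Proof.
by move=> le_ij; rewrite /FK_degen !Fmap_comp //; apply: eq_Fmap => a;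
  apply: K_degen_degen.
Qed.

Definition FK : sset :=
  @SSet FKn FK_face FK_degen FK_face_face FK_face_degen_lt FK_face_degen_eq
    FK_face_degen_eqS FK_face_degen_gt FK_degen_degen.

Definition word_length n (w : FK n) : nat := size w.

(** * The restricted steepness pairing *)

Import Order.DefaultSeqLexiOrder.

(* [Order.lt] on sequences is lexicographic, by [Order.DefaultSeqLexiOrder]. *)
Definition word_lt n (v w : FK n) : bool :=
  (word_length v < word_length w) ||
  (word_length v == word_length w) && (v < w :> seq 'I_n)%O.

Definition restricted_steepness n (x : FK n) (y : FK n.+1) : Prop :=
  exists l : nat,
  [/\ [/\ nondegenerate x, nondegenerate y, word_length x = l &
         word_length y = l],
      regular_face x y,
      forall a : FK n, nondegenerate a -> word_length a = l -> is_face a y ->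
        a <> x -> word_lt a x &
      forall m : FK n.+1, nondegenerate m -> word_length m = l ->
        is_face x m -> m <> y -> word_lt y m].

(* Main.v *)
Require Import Defs.
From mathcomp Require Import all_boot all_order.
From mathcomp Require Import zify.
From Stdlib Require Import Classical.

Set Implicit Arguments.
Unset Strict Implicit.
Unset Printing Implicit Defensive.

Import Order.TTheory.
Import Order.DefaultSeqLexiOrder.

(**
An n-simplex of FK is a word in the letters 0, ..., n-1.  A degeneracy leaves
one letter out, so a word of positive dimension is nondegenerate exactly when
all its letters occur.  The inner faces merge two neighbouring letters, and the
outer faces erase the last or the first letter; hence the faces that keep the
length of a nondegenerate word are its merges.

In a pair, the lower member is the largest nondegenerate face of its length of
the upper member (maximality), and the upper member is the smallest
nondegenerate coface of its length of the lower member (minimality).  Since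
the order on words is asymmetric, each member determines the other.

Maximality alone gives acyclicity and finiteness.  When a path passes from a
lower member, through its partner, to another nondegenerate face of that
partner, the word becomes either shorter or, by maximality, smaller among the
words of its length ([steepness_descent]).  So paths strictly descend in the
shortlex order: they cannot close up, and they cannot be infinite because
there are finitely many words of bounded length over a finite alphabet
([no_infinite_descent]).

What remains is that no simplex is both a lower and an upper member.  Among
the merges of a word, the one that identifies the two largest letters has the
largest letter at every position, so by maximality the lower member of a pair
is this merge of the upper member ([steepness_top_face]).  Consequently the
largest letter occurs at least twice in a lower member ([lower_count_max]).
In an upper member it occurs only once: if one of several occurrences were
replaced by the preceding letter, the word would become smaller, stay
nondegenerate and keep the same merge, against minimality
([upper_count_max]).
*)

(** * The shortlex order *)

Lemma word_lt_irr n (v : FK n) : word_lt v v = false.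
Proof. by rewrite /word_lt ltnn eqxx ltxx. Qed.

Lemma word_lt_trans n : transitive (@word_lt n).
Proof.
rewrite /word_lt => w u v.
case/orP=> [lt_uw|/andP[/eqP -> lt_uw]]; case/orP=> [lt_wv|/andP[/eqP <- lt_wv]].
- by rewrite (ltn_trans lt_uw lt_wv).
- by rewrite lt_uw.
- by rewrite lt_wv.
- by rewrite eqxx (lt_trans lt_uw lt_wv) orbT.
Qed.

Lemma word_lt_asym n (v w : FK n) : word_lt v w -> word_lt w v -> False.
Proof. by move=> /word_lt_trans vw /vw; rewrite word_lt_irr. Qed.

Lemma word_lt_chain n (x : nat -> FK n) k :
  (forall i, i < k -> word_lt (x i.+1) (x i)) ->
  forall i j, i < j -> j <= k -> word_lt (x j) (x i).
Proof.
move=> x_desc i; elim=> // j IHj; rewrite ltnS leq_eqVlt => /predU1P[-> |lt_ij].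
  exact: x_desc.
by move=> lt_jk; apply: word_lt_trans (IHj lt_ij (ltnW lt_jk)); apply: x_desc.
Qed.

(** The terms of a descending sequence would be pairwise distinct words of
bounded length, and these form a finite type. *)
Lemma no_infinite_descent n (x : nat -> FK n) :
  ~ forall i, word_lt (x i.+1) (x i).
Proof.
move=> x_desc; set l := size (x 0).
have lt_x i j : i < j -> word_lt (x j) (x i).
  by move=> lt_ij; apply: (word_lt_chain (k := j)).
have le_xl i : size (x i) <= l.
  case: i => // i; have := lt_x 0 i.+1 isT.
  by rewrite /word_lt /word_length -/l; lia.
pose N := #|{: l.-bseq 'I_n}|.
pose f (i : 'I_N.+1) := Bseq (le_xl i).
have f_inj : injective f.
  move=> i j /(congr1 val) /= eq_x; apply/val_inj.
  by case: (ltngtP i j) => // /lt_x; rewrite eq_x word_lt_irr.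
by have := leq_card f f_inj; rewrite card_ord ltnn.
Qed.

Lemma lexi_map_le n m (f g : 'I_m -> 'I_n) (w : seq 'I_m) :
  (forall a, a \in w -> f a <= g a) -> (map f w <= map g w)%O.
Proof.
elim: w => //= a w IHw le_fg; rewrite lexi_cons.
rewrite leEord le_fg ?mem_head //=; apply/implyP=> _.
by apply: IHw => b wb; rewrite le_fg // inE wb orbT.
Qed.

Lemma ltxi_cat n (p s : seq 'I_n) (a b : 'I_n) : a < b ->
  (p ++ a :: s < p ++ b :: s)%O.
Proof.
move=> lt_ab; elim: p => /= [|c p IHp]; last by rewrite ltxi_cons lexx.
by rewrite ltxi_cons !leEord (ltnW lt_ab) leqNgt lt_ab.
Qed.

(** * Nondegenerate words *)

(** A degeneracy is undone by the face of the same index, except at the letter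
that the degeneracy leaves out. *)
Lemma K_degen_faceK n (j : 'I_n.+1) (a : 'I_n.+1) : a != rev_ord j ->
  K_degen j (K_face (widen_ord (leqnSn _) j) (Some a)) = Some a.
Proof.
rewrite -val_eqE => ne_aj; have lta := ltn_ord a; have ltj := ltn_ord j.
rewrite [_ == _]/= in ne_aj.
rewrite K_degen_face [RHS]Some_alpha /=.
by case: (leqP j (n.+1 - a.+1)) => ?; do !case: ifPn => ?;
  try (congr alpha; lia); lia.
Qed.

Lemma K_degen_skip n (j : 'I_n.+1) (x : Kn n) :
  K_degen j x <> Some (rev_ord j).
Proof.
case: x => // a; have lta := ltn_ord a; have ltj := ltn_ord j.
rewrite /= /alpha; case: ifP => ?; case: insubP => // b _ vb [eb];
  by move: vb; rewrite eb /=; lia.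
Qed.

(** A word that misses a letter is recovered from a face by the degeneracy that
skips this letter, and the image of a degeneracy always misses one. *)
Lemma nondegenerateP n (x : FK n.+1) :
  nondegenerate x <-> forall a : 'I_n.+1, a \in (x : seq _).
Proof.
split=> [ndx a|x_all [j [z x_z]]].
  apply/negP => /negP ax; case: ndx.
  exists (rev_ord a), (FK_face (widen_ord (leqnSn _) (rev_ord a)) x).
  rewrite /= /FK_face /FK_degen Fmap_comp // /Fmap /=.
  have {ax} : all (fun b => b != a) x.
    by apply/allP => b xb; apply: contraNneq ax => <-.
  elim: (x : seq _) => //= b w IHw /andP[ne_ba /IHw <-].
  by rewrite /oapp K_degen_faceK ?rev_ordK.
have := x_all (rev_ord j); rewrite x_z /= /FK_degen /Fmap mem_pmap.
by case/mapP => a _ /esym; apply: K_degen_skip.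
Qed.

Lemma nondegenerate_size n (x : FK n.+1) : nondegenerate x -> 0 < size x.
Proof. by move/nondegenerateP/(_ ord0); case: x. Qed.

(** * Faces *)

Lemma size_is_face n (x : FK n) (y : FK n.+1) : is_face x y -> size x <= size y.
Proof. by case=> i ->; rewrite /= size_pmap count_size. Qed.

(** The generator of largest index is the one that moves first as the face index
grows, so it is the face of index 1 that merges the two largest letters. *)
Definition top_face n : FK n.+2 -> FK n.+1 := face (lift ord0 ord0).

Definition cap n (a : 'I_n.+2) : 'I_n.+1 := inord (minn a n).

Lemma val_cap n (a : 'I_n.+2) : cap a = minn a n :> nat.
Proof. by rewrite inordK // ltnS geq_minr. Qed.

Lemma top_faceE n (y : FK n.+2) : top_face y = map (@cap n) y.
Proof.
transitivity (pmap (fun a => Some (cap a)) y).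
  apply: eq_pmap => a; have lta := ltn_ord a.
  rewrite [RHS]Some_alpha val_cap /= /bump /=.
  by case: ifP => ?; congr alpha; lia.
by elim: (y : seq _) => //= a w ->.
Qed.

(** No face sends a letter higher than the top face does. *)
Lemma K_face_le_cap n (i : 'I_n.+3) (a : 'I_n.+2) (b : 'I_n.+1) :
  K_face i (Some a) = Some b -> b <= cap a.
Proof.
rewrite val_cap /= /alpha; have lta := ltn_ord a; have ltb := ltn_ord b.
case: ifP => _ /=; last case: (nat_of_ord a) lta => // c ltc.
  by case: insubP => // b' _ vb [eb]; move: vb; rewrite eb /=; lia.
by case: insubP => // b' _ vb [eb]; move: vb; rewrite eb /=; lia.
Qed.

Lemma pmap_all_some (S T : Type) (d : T) (f : S -> option T) (w : seq S) :
  all f w -> pmap f w = map (fun a => odflt d (f a)) w.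
Proof. by elim: w => //= a w IHw /andP[+ /IHw ->]; case: (f a). Qed.

Lemma le_top_face n (x : FK n.+1) (y : FK n.+2) :
  is_face x y -> size x = size y -> (x <= top_face y :> seq _)%O.
Proof.
case=> i ->; rewrite top_faceE /= /FK_face /Fmap size_pmap => /eqP.
rewrite -all_count => y_all.
rewrite (pmap_all_some ord0 y_all); apply: lexi_map_le => a /(allP y_all).
by case E : (K_face i (Some a)) => [b|] //= _; apply: K_face_le_cap E.
Qed.

Lemma nondegenerate_top_face n (y : FK n.+2) :
  nondegenerate y -> nondegenerate (top_face y).
Proof.
move=> /nondegenerateP y_all; apply/nondegenerateP => a.
rewrite top_faceE; apply/mapP; exists (widen_ord (leqnSn _) a) => //.
by apply/val_inj; rewrite /= val_cap /=; have := ltn_ord a; lia.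
Qed.

(** * The pairing *)

Lemma steepness_dim_gt0 (x : FK 0) (y : FK 1) : ~ restricted_steepness x y.
Proof.
case=> l [[_ /nondegenerate_size y_gt0 lx ly] _ _ _].
have x0 : size x = 0 by case: (x : seq _) => [|[]].
by move: y_gt0; rewrite -/(word_length y) ly -lx /word_length x0.
Qed.

Lemma steepness_descent n (x a : FK n) (y : FK n.+1) :
  restricted_steepness x y -> nondegenerate a -> is_face a y -> a <> x ->
  word_lt a x.
Proof.
case=> l [[_ _ lx ly] _ max_x _] nda ay ne_ax.
have := size_is_face ay; rewrite -/(word_length y) ly leq_eqVlt.
by case/predU1P=> [la|lt_al]; [apply: max_x | rewrite /word_lt lx lt_al].
Qed.

Lemma steepness_nondegenerate n (x : FK n) (y : FK n.+1) :
  restricted_steepness x y -> nondegenerate x.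
Proof. by case=> l [[]]. Qed.

(** The top face competes with the lower member in the maximality condition, and
is at least as large. *)
Lemma steepness_top_face n (x : FK n.+1) (y : FK n.+2) :
  restricted_steepness x y -> x = top_face y.
Proof.
move=> xy; apply: NNPP => ne_x.
have [l [[ndx ndy lx ly] [i [xi _]] _ _]] := xy.
have := steepness_descent xy (nondegenerate_top_face ndy).
move=> /(_ (ex_intro _ _ erefl)) /(_ (nesym ne_x)).
have le_x : (x <= top_face y :> seq _)%O.
  by apply: le_top_face; [exists i | rewrite -/(word_length x) lx].
rewrite /word_lt ltNge le_x andbF orbF.
by rewrite /word_length top_faceE size_map -/(word_length y) ly -lx ltnn.
Qed.

(** All occurrences of the two largest letters of the upper member become
occurrences of the largest letter in the lower one. *)
Lemma lower_count_max n (x : FK n.+1) (y : FK n.+2) :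
  restricted_steepness x y -> 1 < count_mem ord_max (x : seq _).
Proof.
move=> xy; have [l [[_ /nondegenerateP y_all _ _] _ _ _]] := xy.
rewrite (steepness_top_face xy) top_faceE count_map.
pose b : 'I_n.+2 := widen_ord (leqnSn _) ord_max.
have ne_b : ord_max != b by rewrite -val_eqE /= /b /= gtn_eqF.
have cap_max (a : 'I_n.+2) : n <= a -> cap a == ord_max.
  by move=> le_na; rewrite -val_eqE /= val_cap; lia.
apply: (@leq_trans (count (predU (pred1 ord_max) (pred1 b)) y)).
  have := count_predUI (pred1 ord_max) (pred1 b) (y : seq _).
  rewrite (eq_count (a1 := predI _ _) (a2 := pred0)) ?count_pred0; last first.
    by move=> a /=; apply/negP => /andP[/eqP ->]; apply/negP.
  rewrite addn0 => ->; rewrite -[2]/(1 + 1).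
  by rewrite leq_add // -has_count has_pred1.
by apply: sub_count => a /= /orP[] /eqP ->; apply: cap_max.
Qed.

(** Otherwise one occurrence could be lowered to the preceding letter, which
gives a smaller coface of the lower member than the upper one. *)
Lemma upper_count_max n (x : FK n.+1) (y : FK n.+2) :
  restricted_steepness x y -> count_mem ord_max (y : seq _) <= 1.
Proof.
move=> xy; have [l [[_ /nondegenerateP y_all lx ly] _ _ min_y]] := xy.
rewrite leqNgt; apply/negP => y_twice.
have x_y := steepness_top_face xy.
have [p [s y_ps]] : exists p s, y = p ++ ord_max :: s.
  by case/splitPr: (y_all ord_max) => p s; exists p, s.
pose b : 'I_n.+2 := widen_ord (leqnSn _) ord_max.
have lt_b : b < (ord_max : 'I_n.+2) by [].
pose z : FK n.+2 := p ++ b :: s.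
have lt_zy : (z < y :> seq _)%O by rewrite y_ps; apply: ltxi_cat.
have size_zy : size z = size y by rewrite y_ps !size_cat.
have ndz : nondegenerate z.
  apply/nondegenerateP => a; rewrite mem_cat inE.
  have := y_all a; rewrite y_ps mem_cat inE.
  case: (eqVneq a ord_max) => [-> _|_] /=; last by case/orP=> ->; rewrite ?orbT.
  move: y_twice; rewrite y_ps count_cat /= eqxx.
  by rewrite addnCA ltnS addn_gt0 -!has_count !has_pred1 => /orP[]->; rewrite ?orbT.
have face_z : is_face x z.
  exists (lift ord0 ord0); rewrite -/(top_face z) x_y !top_faceE y_ps !map_cat /=.
  by congr (_ ++ _ :: _); apply/val_inj; rewrite /= !val_cap /=; lia.
have := min_y z ndz; rewrite /word_length size_zy.
move=> /(_ ly face_z); rewrite /word_lt /word_length size_zy ltnn (lt_gtF lt_zy).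
by rewrite andbF => absurd; case: notF; apply: absurd => eq_zy;
  rewrite eq_zy ltxx in lt_zy.
Qed.

Lemma lower_upper_disjoint n (x : FK n) :
  ~ (lower restricted_steepness x /\ upper restricted_steepness x).
Proof.
case: n x => [|[|n]] x [[y xy]] //= [w wx]; first exact: steepness_dim_gt0 wx.
by have := lower_count_max xy; rewrite ltnNge (upper_count_max wx).
Qed.

Lemma steepness_upper_unique n (x : FK n) (y z : FK n.+1) :
  restricted_steepness x y -> restricted_steepness x z -> y = z.
Proof.
move=> [l [[_ ndy lx ly] [i [xi _]] _ min_y]].
move=> [l' [[_ ndz lx' lz] [j [xj _]] _ min_z]].
have eq_l : l' = l by rewrite -lx.
rewrite eq_l in lz min_z; apply: NNPP => ne_yz.
apply: (@word_lt_asym _ y z).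
  by apply: min_y => //; [exists j | apply: nesym].
by apply: min_z => //; exists i.
Qed.

Lemma steepness_lower_unique n (x z : FK n) (y : FK n.+1) :
  restricted_steepness x y -> restricted_steepness z y -> x = z.
Proof.
move=> xy zy; apply: NNPP => ne_xz.
have [l [_ [i [xi _]] _ _]] := xy; have [l' [_ [j [zj _]] _ _]] := zy.
apply: (@word_lt_asym _ x z).
  apply: (steepness_descent zy) => //; last by exists i.
  exact: steepness_nondegenerate xy.
apply: (steepness_descent xy); [|by exists j|exact: nesym].
exact: steepness_nondegenerate zy.
Qed.

Theorem theorem4p2 : @Morse_pairing FK restricted_steepness.
Proof.
split.
- move=> n x; case: (classic (lower restricted_steepness x)) => [lx|nlx].
    by constructor 1.
  case: (classic (upper restricted_steepness x)) => [ux|nux].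
    by constructor 2.
  by constructor 3.
- by move=> n x; split; [apply: lower_upper_disjoint | case=> ? [] | case=> ? []].
- move=> n; split=> [x y xy|x [y xy]|y [x xy]].
  + by split; [exists y | exists x].
  + by exists y; split=> // z; apply: steepness_upper_unique xy.
  + by exists x; split=> // z; apply: steepness_lower_unique xy.
- by move=> n x y [l []].
- move=> n k x y k_gt0 x_inj xy x_face face_0.
  have ndx i : i <= k -> nondegenerate (x i).
    by move=> /xy; apply: steepness_nondegenerate.
  (* The path descends from x 0 to x k, and closing it up would descend back. *)
  have lt_k0 : word_lt (x k) (x 0).
    apply: word_lt_chain k_gt0 (leqnn k) => i lt_ik.
    apply: (steepness_descent (xy i (ltnW lt_ik))); [exact: ndx|exact: x_face|].
    by move/(x_inj _ _ lt_ik (ltnW lt_ik)); lia.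
  apply: (word_lt_asym lt_k0).
  apply: (steepness_descent (xy k (leqnn k)) (ndx 0 _) face_0) => //.
  by move/(x_inj 0 k (leq0n k) (leqnn k)) => k0; rewrite -k0 in k_gt0.
- move=> n x y [_ x_ne xy x_face]; apply: (@no_infinite_descent n x) => i.
  apply: (steepness_descent (xy i)) => //.
  exact: steepness_nondegenerate (xy i.+1).
Qed.
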